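(* An epr-sequence starting with $\mathtt{N}$ is attainable by a symmetric matrix over $\mathbb{Z}_2$ if and only if it has one of the following forms: 1. $\mathtt{NA}\overline{\mathtt{NA}}$; 2. $\mathtt{NA}\overline{\mathtt{NA}}\mathtt{N}$; 3. $\overline{\mathtt{NS}}\mathtt{N}\overline{\mathtt{N}}$; 4. $\mathtt{NS}\overline{\mathtt{NS}}\mathtt{NA}$; 5. $\mathtt{NS}\overline{\mathtt{NS}}\mathtt{NAN}$.
   Context: $\mathbb{Z}_2$ is the field of integers modulo $2$. For an $n\times n$ symmetric matrix $B$ over a field $\mathbb{F}$, the enhanced principal rank characteristic sequence (epr-sequence) is $\operatorname{epr}(B)=\ell_1\ell_2\cdots\ell_n$, where $\ell_k=\mathtt{A}$ if all principal minors of $B$ of order $k$ are nonzero, $\ell_k=\mathtt{S}$ if some but not all principal minors of order $k$ are nonzero, and $\ell_k=\mathtt{N}$ if all principal minors of order $k$ are zero. A finite nonempty sequence over $\{\mathtt{A},\mathtt{S},\mathtt{N}\}$ is attainable over $\mathbb{F}$ if it equals $\operatorname{epr}(B)$ for some symmetric matrix $B$ over $\mathbb{F}$; its order is its length. In a form, an overlined block $\overline{t_1\cdots t_k}$ stands for the block $t_1\cdots t_k$ repeated any number of times $\geq 0$ (so it may be omitted entirely); a sequence ''has a form'' if it is obtained by some choice of the repetition numbers, chosen independently for each overlined block. *)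

(* Defs.v *)
From HB Require Import structures.
From mathcomp Require Import all_boot all_order all_algebra.

Set Implicit Arguments.
Unset Strict Implicit.
Unset Printing Implicit Defensive.

Import GRing.Theory.
Local Open Scope ring_scope.

Inductive epr_symbol : Set := eprA | eprS | eprN.

Definition principal_submx (F : fieldType) (n : nat) (B : 'M[F]_n)
    (a : {set 'I_n}) : 'M[F]_#|a| :=
  mxsub (fun i : 'I_#|a| => enum_val i) (fun j : 'I_#|a| => enum_val j) B.

Definition principal_minor (F : fieldType) (n : nat) (B : 'M[F]_n)
    (a : {set 'I_n}) : F :=
  \det (principal_submx B a).

(* Meaningful for 1 <= k <= n only: for k > n there is no minor of order k
   and the first test holds vacuously. *)
Definition epr_term (F : fieldType) (n : nat) (B : 'M[F]_n) (k : nat)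
    : epr_symbol :=
  if [forall a : {set 'I_n}, (#|a| == k) ==> (principal_minor B a != 0)]
  then eprA
  else if [exists a : {set 'I_n}, (#|a| == k) && (principal_minor B a != 0)]
  then eprS
  else eprN.

Definition epr (F : fieldType) (n : nat) (B : 'M[F]_n) : seq epr_symbol :=
  [seq epr_term B k | k <- iota 1 n].

Definition attainable (F : fieldType) (s : seq epr_symbol) : Prop :=
  exists (n : nat) (B : 'M[F]_n), [/\ (0 < n)%N, B^T = B & epr B = s].

(* The overlined block: t repeated k times, k = 0 allowed. *)
Definition rep (t : seq epr_symbol) (k : nat) : seq epr_symbol :=
  flatten (nseq k t).

(* Main.v *)
(* A symmetric matrix over Z_2 whose sequence starts with N has zero diagonal,
   hence is alternating, and its minors of odd order vanish.  The inverse of an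
   invertible principal submatrix B[a] is alternating as well, and a nonzero
   entry (i, j) of it yields an invertible B[a \ {i, j}]; so an N in an even
   position is followed by N's only.  If all minors of order 2k > 0 are nonzero
   and 2k + 2 <= n, then B = J - I; so an A in an even position which is not one
   of the last two forces the sequence NANA...  Conversely, the forms are realized
   by J - I, by a perfect matching plus isolated vertices, and by triangles
   sharing one vertex.  Throughout, B[a] is singular iff some nonzero vector v
   supported on a is such that v B vanishes on a. *)
Require Import Defs.
From HB Require Import structures.
From mathcomp Require Import all_boot all_order all_algebra zify.

Set Implicit Arguments.
Unset Strict Implicit.
Unset Printing Implicit Defensive.

Import GRing.Theory.
Local Open Scope ring_scope.

Lemma ex_superset_card (T : finType) (a : {set T}) (m : nat) :
  (#|a| <= m <= #|T|)%N -> exists2 b : {set T}, a \subset b & #|b| = m.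
Proof.
elim: m => [|m IHm]; first by rewrite leqn0 andbT => /eqP a0; exists a.
case/andP; rewrite leq_eqVlt => /predU1P [<- _|]; first by exists a.
rewrite ltnS => le_am lt_mT.
have [|b sab bm] := IHm; first by rewrite le_am ltnW.
have: (0 < #|~: b|)%N by have := cardsC b; rewrite bm; lia.
case/card_gt0P => x; rewrite inE => xb; exists (x |: b).
  by rewrite (subset_trans sab) ?subsetUr.
by rewrite cardsU1 xb bm.
Qed.

(** * Principal minors through kernel vectors supported on the index set *)

Section PrincipalMinors.

Variables (F : fieldType) (n : nat).
Implicit Types (B : 'M[F]_n) (a b : {set 'I_n}) (u v w : 'rV[F]_n).

(** Full-length vectors vanishing off [a] replace vectors of length [#|a|], so that minors on
    different sets share one ambient space. *)
Definition supported v a := forall i, i \notin a -> v 0 i = 0.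

Lemma supportedS v a b : a \subset b -> supported v a -> supported v b.
Proof. by move=> sab va i ib; apply: va; apply: contra ib => /(subsetP sab). Qed.

Lemma supportedB v w a : supported v a -> supported w a -> supported (v - w) a.
Proof. by move=> va wa i ia; rewrite !mxE va ?wa ?subr0. Qed.

Lemma supportedZ (c : F) v a : supported v a -> supported (c *: v) a.
Proof. by move=> va i ia; rewrite mxE va ?mulr0. Qed.

Lemma supportedD2 v a i j :
  supported v a -> v 0 i = 0 -> v 0 j = 0 -> supported v (a :\: [set i; j]).
Proof.
move=> va vi0 vj0 l; rewrite !inE negb_and negbK.
by case/orP => [/orP [] /eqP ->|/va].
Qed.

Let restr a v : 'rV[F]_#|a| := \row_k v 0 (enum_val k).

Let mul_restr B a v (l : 'I_#|a|) : supported v a ->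
  (restr a v *m principal_submx B a) 0 l = (v *m B) 0 (enum_val l).
Proof.
move=> va; rewrite !mxE (bigID (mem a)) /= [X in _ + X]big1 ?addr0; last first.
  by move=> i ia; rewrite va ?mul0r.
by rewrite [RHS]big_enum_val; apply: eq_bigr => k _; rewrite !mxE.
Qed.

Let restr_surj a (u : 'rV[F]_#|a|) : exists2 v, supported v a & restr a v = u.
Proof.
(* Extension by zero: the sum has one term when [i] is in [a] and none otherwise. *)
exists (\row_i \sum_(k | enum_val k == i) u 0 k).
  move=> i ia; rewrite mxE big1 // => k /eqP ki.
  by move: ia; rewrite -ki enum_valP.
apply/rowP => l; rewrite !mxE; under eq_bigl do rewrite (inj_eq enum_val_inj).
by rewrite big_pred1_eq.
Qed.

Lemma principal_minor_eq0P B a :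
  reflect (exists v, [/\ v != 0, supported v a
                       & {in a, forall j, (v *m B) 0 j = 0}])
          (principal_minor B a == 0).
Proof.
apply: (iffP det0P) => [[u u0 uB]|[v [v0 va vB]]].
  have [v va vu] := restr_surj u; exists v; split=> // [|j ja].
    apply: contraNneq u0 => v0; apply/eqP/rowP => k.
    by rewrite -vu v0 !mxE.
  have := mul_restr B (enum_rank_in ja j) va.
  by rewrite vu uB enum_rankK_in // mxE.
exists (restr a v); last first.
  by apply/rowP => l; rewrite mul_restr // vB ?mxE // enum_valP.
apply: contraNneq v0 => r0; apply/eqP/rowP => j; rewrite mxE.
have [ja|/va //] := boolP (j \in a).
by have /rowP /(_ (enum_rank_in ja j)) := r0; rewrite !mxE enum_rankK_in.
Qed.

Lemma principal_minor_inj B a v : principal_minor B a != 0 ->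
  supported v a -> {in a, forall j, (v *m B) 0 j = 0} -> v = 0.
Proof.
move=> /principal_minor_eq0P Ba va vB; apply/eqP; apply: contra_notT Ba => v0.
by exists v.
Qed.

(** When [u] is the unit vector at some [i] in [a], [v] is row [i] of the inverse of B[a], padded
    with zeros. *)
Lemma principal_minor_surj B a u : principal_minor B a != 0 ->
  exists2 v, supported v a & {in a, forall j, (v *m B) 0 j = u 0 j}.
Proof.
move=> Ba; have [v va vu] := restr_surj (restr a u *m invmx (principal_submx B a)).
exists v => // j ja; have := mul_restr B (enum_rank_in ja j) va.
rewrite vu mulmxKV ?unitmxE ?unitfE // enum_rankK_in // => <-.
by rewrite mxE enum_rankK_in.
Qed.

Lemma principal_minor_row0 B a i :
  i \in a -> {in a, forall j, B i j = 0} -> principal_minor B a = 0.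
Proof.
move=> ia Bi; apply/eqP/principal_minor_eq0P; exists (delta_mx 0 i).
split=> [|j ja|j ja]; last by rewrite -rowE mxE Bi.
  by apply/eqP => /rowP /(_ i); rewrite !mxE !eqxx; apply/eqP/oner_neq0.
by rewrite mxE /=; case: eqP ja => [->|//]; rewrite ia.
Qed.

Lemma eq_principal_minor B (C : 'M[F]_n) a :
  {in a &, forall i j, B i j = C i j} -> principal_minor B a = principal_minor C a.
Proof.
move=> BC; congr (\det _); apply/matrixP => k l.
by rewrite !mxE BC ?enum_valP.
Qed.

Lemma principal_minor_set1 B i : principal_minor B [set i] = 0 -> B i i = 0.
Proof.
move=> /eqP /principal_minor_eq0P [v [v0 vi /(_ i (set11 i))]].
have v_other j : j != i -> v 0 j = 0 by move=> ji; rewrite vi ?inE.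
rewrite mxE (bigD1 i) //= big1 ?addr0 => [/eqP|j /v_other ->]; last by rewrite mul0r.
rewrite mulf_eq0 => /orP [/eqP vi0|/eqP //]; case/eqP: v0; apply/rowP => j.
by rewrite mxE; have [->|/v_other] := eqVneq j i.
Qed.

(** Here [v] acts as the padded row [i] of the inverse of B[a]; with [w] another such row, an entry
    of the inverse becomes a value of the bilinear form. *)
Lemma mul_supported_delta B a v w i : supported w a -> i \in a ->
  {in a, forall j, (v *m B) 0 j = (delta_mx 0 i : 'rV[F]_n) 0 j} ->
  (v *m B *m w^T) 0 0 = w 0 i.
Proof.
move=> wa ia vB; rewrite mxE (bigD1 i) //= big1 ?addr0.
  by rewrite vB // !mxE !eqxx mul1r.
move=> j ji; have [ja|ja] := boolP (j \in a); last by rewrite [X in _ * X]mxE wa ?mulr0.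
by rewrite vB // !mxE (negbTE ji) mul0r.
Qed.

(** With [U] the strict upper triangle of [B], the two halves of U - U^T give the same scalar; no
    division by 2 occurs, so characteristic 2 is covered. *)
Lemma mul_alternating B v :
  B^T = - B -> (forall i, B i i = 0) -> v *m B *m v^T = 0.
Proof.
move=> BT B0; pose U : 'M[F]_n := \matrix_(i, j) if (i < j)%N then B i j else 0.
have -> : B = U - U^T.
  apply/matrixP => i j; rewrite !mxE.
  have BN k l : B k l = - B l k by have /matrixP /(_ l k) := BT; rewrite !mxE.
  by case: (ltngtP i j) => [|_|/val_inj ->]; rewrite ?subr0 ?sub0r ?B0.
rewrite mulmxBr mulmxBl; apply/eqP; rewrite subr_eq0; apply/eqP.
have -> : v *m U^T *m v^T = (v *m U *m v^T)^T by rewrite !trmx_mul trmxK mulmxA.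
by apply/rowP => i; rewrite [RHS]mxE !ord1.
Qed.

(* Some off-diagonal entry v_i j of the inverse of B[a] is nonzero; a kernel
   vector of B[a \ {i, j}] would be a combination of rows i and j of this
   inverse that vanishes at i and j. *)
Lemma alternating_minor_sub2 B a i :
  B^T = - B -> (forall i, B i i = 0) -> principal_minor B a != 0 -> i \in a ->
  exists2 b : {set 'I_n}, #|b|.+2 = #|a| & principal_minor B b != 0.
Proof.
move=> BT B0 Ba ia.
have [v va vB] := principal_minor_surj (delta_mx 0 i) Ba.
have vi0 : v 0 i = 0.
  by rewrite -(mul_supported_delta va ia vB) mul_alternating ?mxE.
have /eqP/rowP : v != 0.
  apply/eqP => v0; have := vB i ia; rewrite v0 mul0mx !mxE !eqxx => /esym/eqP.
  by rewrite oner_eq0.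
have [/existsP [j vj0] _|/existsPn v0 []] := boolP [exists j, v 0 j != 0]; last first.
  by move=> j; rewrite mxE; apply/eqP; rewrite -[_ == _]negbK v0.
have ja : j \in a by apply: contraNT vj0 => /va ->.
have ji : j != i by apply: contraNneq vj0 => ->; rewrite vi0.
exists (a :\: [set i; j]).
  by rewrite -setDDl (cardsD1 i a) ia (cardsD1 j (a :\ i)) !inE ji ja.
have [v' v'a v'B] := principal_minor_surj (delta_mx 0 j) Ba.
have v'j0 : v' 0 j = 0.
  by rewrite -(mul_supported_delta v'a ja v'B) mul_alternating ?mxE.
(* The inverse is skew-symmetric: [v' 0 i] is minus [v 0 j]. *)
have v'i0 : v' 0 i != 0.
  rewrite -(mul_supported_delta v'a ia vB).
  have -> : v *m B *m v'^T = - (v' *m B *m v^T)^T.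
    by rewrite !trmx_mul trmxK BT mulNmx mulmxN opprK mulmxA.
  by rewrite 2!mxE (mul_supported_delta va ja v'B) oppr_eq0.
apply/principal_minor_eq0P => -[w [w0 wa wB]].
have dE l k : (delta_mx 0 l : 'rV[F]_n) 0 k = (k == l)%:R by rewrite mxE.
have combE (c d : F) x y k :
  (c *: x + d *: y : 'rV[F]_n) 0 k = c * x 0 k + d * y 0 k by rewrite !mxE.
have wE : w = (w *m B) 0 i *: v + (w *m B) 0 j *: v'.
  apply/eqP; rewrite -subr_eq0; apply/eqP/(principal_minor_inj Ba) => [|k ka].
    rewrite opprD addrA; do ![apply: supportedB | apply: supportedZ] => //.
    by apply: supportedS wa; rewrite subsetDl.
  rewrite mulmxBl mulmxDl -!scalemxAl mxE [X in _ + X]mxE combE vB ?v'B // !dE.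
  have [->|ki] := eqVneq k i.
    have [ij|_] := eqVneq i j; last by rewrite mulr1 mulr0 addr0 mxE subrr.
    by case/eqP: v'i0; rewrite ij.
  have [->|kj] := eqVneq k j; first by rewrite mulr1 mulr0 add0r mxE subrr.
  rewrite !mulr0 addr0 subr0; have := wB k; rewrite mxE; apply.
  by rewrite !inE negb_or ki kj.
have w_at k : k \in [set i; j] -> w 0 k = 0.
  by move=> kij; apply: wa; rewrite inE kij.
move: w0; rewrite wE.
have := w_at i (set21 _ _); rewrite {1}wE combE vi0 mulr0 add0r.
move/eqP; rewrite mulf_eq0 (negbTE v'i0) orbF => /eqP ->.
have := w_at j (set22 _ _); rewrite {1}wE combE v'j0 mulr0 addr0.
move/eqP; rewrite mulf_eq0 (negbTE vj0) orbF => /eqP ->.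
by rewrite !scale0r addr0 eqxx.
Qed.

(** Deleting two indices at a time keeps the order odd, so a nonzero minor of odd order would start
    an infinite descent. *)
Lemma alternating_odd_minor B a :
  B^T = - B -> (forall i, B i i = 0) -> odd #|a| -> principal_minor B a = 0.
Proof.
move=> BT B0; have [m] := ubnP #|a|; elim: m a => // m IHm a am oa.
apply/eqP; apply: contraTT isT => Ba.
have /card_gt0P [i ia] : (0 < #|a|)%N by case: #|a| oa.
have [b b2 /eqP []] := alternating_minor_sub2 BT B0 Ba ia.
by apply: IHm; move: am oa; rewrite -b2 /= ?negbK //; lia.
Qed.

End PrincipalMinors.

(** * Symmetric matrices with zero diagonal over the two-element field *)

Section F2.

Implicit Types (n k : nat).

Lemma F2_neq0 (x : 'F_2) : (x != 0) = (x == 1).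
Proof. by case: x => [[|[|]]]. Qed.

Lemma F2_opp (x : 'F_2) : - x = x.
Proof. by apply/val_inj; case: x => [[|[|]]]. Qed.

Lemma F2_natr m : m%:R = (odd m)%:R :> 'F_2.
Proof. by apply/val_inj; rewrite /= !val_Fp_nat // modn2; case: (odd m). Qed.

Lemma F2_opp_mx m n (B : 'M['F_2]_(m, n)) : - B = B.
Proof. by apply/matrixP => i j; rewrite mxE F2_opp. Qed.

Lemma sym_odd_minor n (B : 'M['F_2]_n) (a : {set 'I_n}) :
  B^T = B -> (forall i, B i i = 0) -> odd #|a| -> principal_minor B a = 0.
Proof. by move=> BT; apply: alternating_odd_minor; rewrite F2_opp_mx. Qed.

(* If b has 2k + 2 elements and B[b] is invertible, then every off-diagonal
   entry of its inverse is, up to a unit, a minor of order 2k, so the inverse is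
   J - I and so is B[b].  If B[b] is singular, its kernel contains two
   independent vectors u and w no nonzero combination of which vanishes at two
   points of b, although #|b| >= 4. *)
Lemma even_minors_complete n (B : 'M['F_2]_n) k :
  B^T = B -> (forall i, B i i = 0) -> (0 < k)%N -> (k.*2.+2 <= n)%N ->
  (forall a : {set 'I_n}, #|a| = k.*2 -> principal_minor B a != 0) ->
  forall i j, i != j -> B i j = 1.
Proof.
move=> BT B0 k_gt0 le_kn Bk i j ij.
have [|b] := @ex_superset_card _ [set i; j] k.*2.+2.
  by rewrite cards2 ij card_ord le_kn ltnS; lia.
rewrite subUset !sub1set => /andP [ib jb] bk.
(* Such a [v] is supported on [b] minus two points, a set of order 2k, whose minor is nonzero by
   hypothesis. *)
have kill v x y : supported v b -> x \in b -> y \in b -> x != y ->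
    v 0 x = 0 -> v 0 y = 0 ->
    {in b, forall z, z != x -> z != y -> (v *m B) 0 z = 0} -> v = 0.
  move=> vb xb yb xy vx vy vB; apply: (@principal_minor_inj _ _ B (b :\: [set x; y])).
  - apply: Bk; rewrite -setDDl; apply/eqP; move: bk.
    by rewrite (cardsD1 x b) xb (cardsD1 y (b :\ x)) !inE (eq_sym y) xy yb => -[/eqP].
  - exact: supportedD2.
  - by move=> z; rewrite !inE negb_or -andbA => /and3P [zx zy zb]; apply: vB.
have dE l z : (delta_mx 0 l : 'rV['F_2]_n) 0 z = (z == l)%:R by rewrite mxE.
have [/eqP/principal_minor_eq0P [w [w0 wb wB]]|Bb] := eqVneq (principal_minor B b) 0.
  have [x xb wx] : exists2 x, x \in b & w 0 x != 0.
    apply/exists_inP; apply: contraNT w0 => /exists_inPn w0.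
    apply/eqP/rowP => z; rewrite mxE; have [/w0/negPn/eqP //|/wb //] := boolP (z \in b).
  (* The order 2k + 1 is odd, which yields a second kernel vector, vanishing at [x] unlike [w]. *)
  have /eqP/principal_minor_eq0P [u [u0 ub uB]] : principal_minor B (b :\ x) = 0.
    apply: sym_odd_minor => //; move: bk; rewrite (cardsD1 x) xb add1n => -[->].
    by rewrite /= odd_double.
  have ux : u 0 x = 0 by apply: ub; rewrite !inE eqxx.
  have {}ub : supported u b by apply: supportedS ub; rewrite subsetDl.
  (* By symmetry of [B], u B w^T = w B u^T = 0, and the left side reduces to its term at [x], where
     [w] is nonzero. *)
  have uBx : (u *m B) 0 x = 0.
    have : (u *m B *m w^T) 0 0 = (w *m B *m u^T) 0 0.
      by rewrite -[in RHS]BT -[in RHS](trmxK w) -mulmxA -!trmx_mul [RHS]mxE.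
    rewrite mxE [RHS]mxE [RHS]big1 => [|z _]; last first.
      have [zb|zb] := boolP (z \in b); first by rewrite wB ?mul0r.
      by rewrite [X in _ * X]mxE ub ?mulr0.
    rewrite (bigD1 x) //= big1 ?addr0 => [/eqP|z zx].
      by rewrite [X in _ * X]mxE mulf_eq0 (negbTE wx) orbF => /eqP.
    have [zb|zb] := boolP (z \in b); first by rewrite uB ?mul0r // !inE zx.
    by rewrite [X in _ * X]mxE wb ?mulr0.
  have {}uB : {in b, forall z, (u *m B) 0 z = 0}.
    by move=> z zb; have [->//|zx] := eqVneq z x; apply: uB; rewrite !inE zx.
  have u1 y : y \in b -> y != x -> u 0 y = 1.
    move=> yb yx; apply/eqP; rewrite -F2_neq0; apply: contraNneq u0 => uy.
    by apply/eqP; apply: (kill u x y) => //; [rewrite eq_sym|move=> z /uB].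
  (* At least three points and only two values: [w] agrees at some [y] and [z], where [u] is 1, so
     [kill] applies to [w - w 0 y *: u]. *)
  have /dinjectivePn [y yb [z]] : ~~ dinjectiveb (fun z => w 0 z) (mem (b :\ x)).
    apply/negP => /dinjectiveP /leq_card_in; rewrite card_Fp //.
    have -> : #|mem (b :\ x)| = k.*2.+1.
      by move: bk; rewrite (cardsD1 x) xb add1n => -[].
    lia.
  rewrite !inE => /and3P [zy zx zb] wyz; move: yb; rewrite !inE => /andP [yx yb].
  have /rowP/(_ x) : w - w 0 y *: u = 0.
    apply: (kill _ y z) => //.
    - by apply: supportedB => //; apply: supportedZ.
    - by rewrite eq_sym.
    - by rewrite !mxE u1 // mulr1 subrr.
    - by rewrite !mxE u1 // mulr1 wyz subrr.
    - move=> t tb _ _; rewrite mulmxBl -scalemxAl mxE wB // add0r mxE.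
      by rewrite [X in - X]mxE uB // mulr0 oppr0.
  by rewrite !mxE ux mulr0 subr0 => /eqP; rewrite (negbTE wx).
(* Row [x] of the inverse of B[b]: a zero off the diagonal would let [kill] annihilate it. *)
have inv x : x \in b -> exists v, [/\ supported v b,
    {in b, forall z, (v *m B) 0 z = (z == x)%:R}, v 0 x = 0
    & {in b, forall z, z != x -> v 0 z = 1}].
  move=> xb; have [v vb vB] := principal_minor_surj (delta_mx 0 x) Bb.
  have vx : v 0 x = 0.
    by rewrite -(mul_supported_delta vb xb vB) mul_alternating ?mxE ?F2_opp_mx.
  exists v; split=> // z zb; first by rewrite vB.
  move=> zx; apply/eqP; rewrite -F2_neq0; apply/eqP => vz.
  have v0 : v = 0.
    apply: (kill v x z) => //; first by rewrite eq_sym.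
    by move=> t tb tx _; rewrite vB // dE (negbTE tx).
  by have := vB x xb; rewrite v0 mul0mx dE eqxx mxE => /esym/eqP; rewrite oner_eq0.
have [v [vb vB vi v1]] := inv i ib; have [v' [v'b v'B v'j v'1]] := inv j jb.
(* Rows [i] and [j] of J - I differ by two unit vectors; multiplying by [B] and reading coordinate
   [i] gives [B j i = 1]. *)
have vv' : v - v' = delta_mx 0 j - delta_mx 0 i.
  apply/rowP => z; rewrite mxE [X in _ + X]mxE [RHS]mxE [X in _ = _ + X]mxE !dE.
  have [->|zi] := eqVneq z i; first by rewrite vi v'1 // (negbTE ij).
  have [->|zj] := eqVneq z j; first by rewrite v'j v1 // eq_sym.
  have [zb|zb] := boolP (z \in b); last by rewrite vb // v'b.
  by rewrite v1 ?v'1 // subrr subr0.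
have := congr1 (fun x => (x *m B) 0 i) vv'.
rewrite !mulmxBl -!rowE mxE [X in _ + X]mxE [RHS]mxE [X in _ = _ + X]mxE.
rewrite vB ?v'B // eqxx (negbTE ij) !subr0 !mxE B0 subr0 => Bji.
by have /matrixP/(_ i j) := BT; rewrite mxE -Bji.
Qed.

(** A kernel vector of B[a] has every entry on [a] equal to the sum [S] of all its entries; then [S]
    is [#|a|] times itself, which is 0 for even [#|a|]. *)
Lemma complete_minor n (B : 'M['F_2]_n) (a : {set 'I_n}) :
  (forall i, B i i = 0) -> (forall i j, i != j -> B i j = 1) ->
  ~~ odd #|a| -> principal_minor B a != 0.
Proof.
move=> B0 B1 ea; apply/principal_minor_eq0P => -[v [v0 va vB]].
pose S := \sum_i v 0 i.
have vS : {in a, forall j, v 0 j = S}.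
  move=> j /vB; rewrite mxE (bigD1 j) //= B0 mulr0 add0r => Bj.
  rewrite /S (bigD1 j) //= -[LHS]addr0 -[in LHS]Bj; congr (_ + _).
  by apply: eq_bigr => i ij; rewrite B1 // mulr1.
have S0 : S = 0.
  rewrite /S (bigID (mem a)) /= [X in _ + X]big1 ?addr0 => [|i /va //].
  by rewrite (eq_bigr (fun=> S)) // sumr_const -mulr_natr F2_natr (negbTE ea) mulr0.
case/eqP: v0; apply/rowP => j; rewrite mxE.
by have [/vS ->|/va //] := boolP (j \in a).
Qed.

End F2.

(** * Characterizations of the terms of an epr-sequence *)

Section EprTerms.

Variables (F : fieldType) (n : nat) (B : 'M[F]_n).

Lemma epr_term_AP k :
  epr_term B k = eprA <->
  (forall a : {set 'I_n}, #|a| = k -> principal_minor B a != 0).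
Proof.
rewrite /epr_term; split=> [|allB].
  case: forallP => [allB _ a ak|]; last by case: existsP.
  by have := allB a; rewrite ak eqxx.
by case: forallP => // -[] a; apply/implyP => /eqP /allB.
Qed.

(** The bound provides a set of order [k]; beyond it the term is [eprA] by vacuity. *)
Lemma epr_term_NP k : (k <= n)%N ->
  epr_term B k = eprN <->
  (forall a : {set 'I_n}, #|a| = k -> principal_minor B a = 0).
Proof.
move=> le_kn; rewrite /epr_term; split=> [|allB].
  case: forallP => // _; case: existsP => // exB _ a ak.
  by apply/eqP; apply: contra_notT exB => Ba; exists a; rewrite ak eqxx.
case: forallP => [nonzero|_].
  have [|a _ ak] := @ex_superset_card _ (set0 : {set 'I_n}) k.
    by rewrite cards0 card_ord.
  by have := nonzero a; rewrite ak allB // !eqxx.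
by case: existsP => // -[a /andP [/eqP /allB ->]]; rewrite eqxx.
Qed.

Lemma epr_term_S k (a b : {set 'I_n}) :
  #|a| = k -> principal_minor B a != 0 -> #|b| = k -> principal_minor B b = 0 ->
  epr_term B k = eprS.
Proof.
move=> ak Ba bk Bb; rewrite /epr_term; case: forallP => [/(_ b)|_].
  by rewrite bk Bb !eqxx.
by case: existsP => // -[]; exists a; rewrite ak eqxx.
Qed.

(** The full set gives the only minor of order [n]. *)
Lemma epr_term_last : epr_term B n <> eprS.
Proof.
have setTn (a : {set 'I_n}) : #|a| = n -> a = setT.
  by move=> an; apply/eqP; rewrite eqEcard subsetT cardsT card_ord an /=.
rewrite /epr_term; case: forallP => // all; case: existsP => //.
case=> a /andP [/eqP /setTn -> BT].
by case: all => b; apply/implyP => /eqP /setTn ->.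
Qed.

End EprTerms.

Lemma map_iota_rep2 (f : nat -> epr_symbol) x y m k :
  (forall i, (i < k)%N -> f (m + i.*2)%N = x /\ f (m + i.*2).+1 = y) ->
  [seq f i | i <- iota m k.*2] = rep [:: x; y] k.
Proof.
elim: k m => // k IHk m fm; rewrite doubleS /=.
have [] := fm 0%N isT; rewrite addn0 => -> ->; rewrite (IHk m.+2) // => i ik.
by have := fm i.+1 ik; rewrite doubleS !addnS !addSn.
Qed.

Lemma map_iota_rep1 (f : nat -> epr_symbol) x m k :
  (forall i, (i < k)%N -> f (m + i)%N = x) -> [seq f i | i <- iota m k] = rep [:: x] k.
Proof.
elim: k m => // k IHk m fm /=; have := fm 0%N isT; rewrite addn0 => ->.
by rewrite (IHk m.+1) // => i ik; rewrite addSnnS; apply: fm.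
Qed.

(** * Constraints on the terms when the diagonal is zero *)

Section SymmetricZeroDiagonal.

Variables (n : nat) (B : 'M['F_2]_n).
Hypotheses (BT : B^T = B) (B0 : forall i, B i i = 0).

Lemma epr_term_odd k : (k <= n)%N -> odd k -> epr_term B k = eprN.
Proof.
by move=> kn ok; apply/epr_term_NP => // a ak; apply: sym_odd_minor; rewrite ?ak.
Qed.

Lemma epr_term_N_next k : (k.+2 <= n)%N ->
  epr_term B k = eprN -> epr_term B k.+2 = eprN.
Proof.
move=> kn /(epr_term_NP B (ltnW (ltnW kn))) Bk; apply/epr_term_NP => // a ak.
have [i ia] : exists i, i \in a by apply/card_gt0P; rewrite ak.
apply/eqP; apply: contraTT isT => Ba.
have BN : B^T = - B by rewrite F2_opp_mx.
have [b b2 /eqP []] := alternating_minor_sub2 BN B0 Ba ia.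
by apply: Bk; move: b2; rewrite ak => -[].
Qed.

Lemma epr_term_A_complete k : (0 < k)%N -> (k.*2.+2 <= n)%N ->
  epr_term B k.*2 = eprA -> forall i j, i != j -> B i j = 1.
Proof. by move=> k0 kn /epr_term_AP; apply: even_minors_complete. Qed.

Lemma epr_term_complete k : (forall i j, i != j -> B i j = 1) ->
  ~~ odd k -> epr_term B k = eprA.
Proof. by move=> B1 ek; apply/epr_term_AP => a ak; rewrite complete_minor ?ak. Qed.

(** Odd terms are N automatically, so a block decomposition only needs the even terms; the last [r]
    terms are left open. *)
Lemma epr_rep_cat x k r : n = (k.*2 + r)%N ->
  (forall i, (0 < i <= k)%N -> epr_term B i.*2 = x) ->
  epr B = rep [:: eprN; x] k ++ [seq epr_term B i | i <- iota k.*2.+1 r].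
Proof.
move=> nE Bx; rewrite /epr [in iota 1 n]nE iotaD map_cat add1n.
rewrite (@map_iota_rep2 _ eprN x) // => i ik; rewrite add1n -doubleS Bx //; split=> //.
by apply: epr_term_odd; rewrite /= ?odd_double //; lia.
Qed.

End SymmetricZeroDiagonal.

Lemma card_ord_lt n m : (m <= n)%N -> #|[set i : 'I_n | (i < m)%N]| = m.
Proof.
by move=> mn; rewrite -sum1dep_card -(big_ord_widen n (fun=> 1%N)) // sum1_card card_ord.
Qed.

(** * Perfect matching plus isolated vertices *)

Section Pairing.

Variables n k : nat.
(* The perfect matching 2i -- 2i+1 on the vertices below 2k; the other vertices
   are isolated. *)
Definition pairing_mx : 'M['F_2]_n :=
  \matrix_(i, j) [&& i != j, i./2 == j./2 & (i < k.*2)%N]%:R.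

Lemma pairing_mx_tr : pairing_mx^T = pairing_mx.
Proof.
apply/matrixP => i j; rewrite !mxE -!val_eqE /=; congr (nat_of_bool _)%:R.
by apply/and3P/and3P => -[]; split; lia.
Qed.

Lemma pairing_mx_diag i : pairing_mx i i = 0.
Proof. by rewrite mxE eqxx. Qed.

Lemma pairing_mx_out (i j : 'I_n) : (k.*2 <= i)%N -> pairing_mx i j = 0.
Proof. by move=> ki; rewrite mxE (ltnNge i) ki !andbF. Qed.

Lemma mul_pairing_mx (v : 'rV_n) (i j : 'I_n) :
  i != j -> i./2 = j./2 -> (i < k.*2)%N -> (v *m pairing_mx) 0 j = v 0 i.
Proof.
move=> ij ij2 ik; rewrite mxE (bigD1 i) //= big1 ?addr0 => [|l li].
  by rewrite mxE ij ij2 eqxx ik mulr1.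
rewrite mxE; case: and3P => [[lj /eqP lj2 lk]|_]; last by rewrite mulr0.
by move: ij li lj; rewrite -!val_eqE /=; lia.
Qed.

(** Dropping vertex 1 from 0, ..., 2t leaves 0 without its mate, so its row vanishes on the set. The
    bound on the elements keeps the centre of the windmill out. *)
Lemma pairing_minor_eq0 t : (0 < t)%N -> (t.*2 < n)%N ->
  exists a : {set 'I_n}, [/\ #|a| = t.*2, {in a, forall i : 'I_n, (i <= t.*2)%N}
                           & principal_minor pairing_mx a = 0].
Proof.
move=> t0 tn; have n0 : (0 < n)%N by lia.
have n1 : (1 < n)%N by lia.
exists ([set i : 'I_n | (i < t.*2.+1)%N] :\ Ordinal n1); split.
- have := card_ord_lt tn; rewrite (cardsD1 (Ordinal n1)) inE /=.
  have -> : (1 < t.*2.+1)%N by lia.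
  by rewrite add1n => -[].
- by move=> i; rewrite !inE => /andP [].
- apply: (@principal_minor_row0 _ _ _ _ (Ordinal n0)) => [|j]; first by rewrite !inE.
  rewrite !inE mxE -!val_eqE /= => /andP [j1 _].
  by case: and3P => // -[]; lia.
Qed.

Hypothesis le_kn : (k.*2 <= n)%N.

Lemma pairing_mate (i : 'I_n) : (i < k.*2)%N ->
  exists j : 'I_n, [/\ j != i, j./2 = i./2 & (j < k.*2)%N].
Proof.
(* The mate flips the last bit of [i], which cannot cross the even bound 2k. *)
move=> ik; pose m : nat := if odd i then i.-1 else i.+1.
have mk : (m < k.*2)%N by rewrite /m; case: ifP; lia.
exists (Ordinal (leq_trans mk le_kn)); split=> //=.
  by rewrite -val_eqE /= /m; case: ifP; lia.
by rewrite /m; case: ifP; lia.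
Qed.

(** The first 2t vertices form whole pairs, so each entry of a kernel vector is read off at the
    mate. *)
Lemma pairing_minor_neq0 t : (t <= k)%N ->
  principal_minor pairing_mx [set i : 'I_n | (i < t.*2)%N] != 0.
Proof.
move=> tk; apply/principal_minor_eq0P => -[v [v0 va vB]].
case/eqP: v0; apply/rowP => i; rewrite mxE.
have [it|it] := ltnP i t.*2; last by apply: va; rewrite inE -leqNgt.
have ik : (i < k.*2)%N by lia.
have [j [ji j2 jk]] := pairing_mate ik.
by rewrite -(@mul_pairing_mx v i j) 1?eq_sym // vB // inE; lia.
Qed.

Lemma pairing_epr_S t : (0 < t <= k)%N -> (t.*2 < n)%N ->
  epr_term pairing_mx t.*2 = eprS.
Proof.
case/andP => t0 tk tn; have [a [at2 _ a0]] := pairing_minor_eq0 t0 tn.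
exact: (epr_term_S (card_ord_lt (ltnW tn)) (pairing_minor_neq0 tk) at2 a0).
Qed.

(** More than 2k vertices must include an isolated one, hence a zero row. *)
Lemma pairing_epr_N j : (k.*2 < j <= n)%N -> epr_term pairing_mx j = eprN.
Proof.
case/andP => kj jn; apply/epr_term_NP => // a aj.
have /subsetPn [i ia] : ~~ (a \subset [set i : 'I_n | (i < k.*2)%N]).
  by apply/negP => /subset_leq_card; rewrite card_ord_lt // aj leqNgt kj.
rewrite inE -leqNgt => ik.
by apply: (principal_minor_row0 ia) => l _; apply: pairing_mx_out.
Qed.

End Pairing.

Lemma pairing_epr_A k : epr_term (pairing_mx k.*2 k) k.*2 = eprA.
Proof.
apply/epr_term_AP => a ak; have := pairing_minor_neq0 (leqnn k.*2) (leqnn k).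
congr (principal_minor _ _ != 0); apply/esym/eqP; rewrite eqEcard.
by rewrite card_ord_lt // ak leqnn andbT; apply/subsetP => i _; rewrite inE.
Qed.

(** * Triangles sharing one vertex *)

Section Windmill.

Variable m : nat.
Let c : 'I_m.*2.+1 := ord_max.

(* m triangles sharing the vertex c. *)
Definition windmill_mx : 'M['F_2]_m.*2.+1 :=
  pairing_mx m.*2.+1 m + \matrix_(i, j) ((i == c) != (j == c))%:R.

Lemma windmill_mx_tr : windmill_mx^T = windmill_mx.
Proof.
rewrite /windmill_mx linearD /=; apply: (congr2 +%R); first exact: pairing_mx_tr.
by apply/matrixP => i j; rewrite !mxE eq_sym.
Qed.

Lemma windmill_mx_diag i : windmill_mx i i = 0.
Proof. by rewrite mxE pairing_mx_diag mxE eqxx addr0. Qed.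

Lemma windmill_minor (a : {set 'I_m.*2.+1}) : c \notin a ->
  principal_minor windmill_mx a = principal_minor (pairing_mx m.*2.+1 m) a.
Proof.
have ac i : c \notin a -> i \in a -> (i == c) = false.
  by move=> ca ia; apply: contraNF ca => /eqP <-.
move=> ca; apply: eq_principal_minor => i j ia ja.
by rewrite mxE [X in _ + X]mxE !ac // addr0.
Qed.

Lemma mul_windmill_mx (v : 'rV_m.*2.+1) (i j : 'I_m.*2.+1) :
  i != j -> i./2 = j./2 -> (i < m.*2)%N ->
  (v *m windmill_mx) 0 j = v 0 i + v 0 c.
Proof.
move=> ij ij2 im; rewrite mulmxDr mxE (mul_pairing_mx _ ij) //.
congr (_ + _).
have jc : (j == c) = false.
  by apply/negbTE; move: im; rewrite -val_eqE /=; lia.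
rewrite mxE (bigD1 c) //= big1 ?addr0 => [|l lc].
  by rewrite mxE jc eqxx mulr1.
by rewrite mxE jc (negbTE lc) mulr0.
Qed.

Lemma windmill_center (i : 'I_m.*2.+1) : i != c -> (i < m.*2)%N.
Proof. by have := ltn_ord i; rewrite -val_eqE /=; lia. Qed.

(** All degrees are even: 2m at the centre, and 2 elsewhere (the mate and the centre). *)
Lemma windmill_kernel : (const_mx 1 : 'rV_m.*2.+1) *m windmill_mx = 0.
Proof.
apply/rowP => j; have [->|/windmill_center jm] := eqVneq j c.
  rewrite mulmxDr [LHS]mxE [X in X + _]mxE big1 ?add0r => [|i _]; last first.
    rewrite -[pairing_mx _ _]pairing_mx_tr [X in _ * X]mxE pairing_mx_out ?mulr0 //=.
  rewrite mxE (bigD1 c) //= !mxE eqxx mulr0 add0r.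
  rewrite (eq_bigr (fun=> 1)) => [|i ic]; last by rewrite !mxE (negbTE ic) eqxx mulr1.
  by rewrite sumr_const cardC1 card_ord F2_natr odd_double.
have [i [ij i2 im]] := pairing_mate (leqnSn _) jm.
by rewrite (mul_windmill_mx _ ij) // !mxE -[X in X + _]F2_opp addNr.
Qed.

(* If v vanishes at x and v *m windmill_mx vanishes off x, then the latter is 0,
   since it is orthogonal to the all-ones vector; comparing columns then shows
   that v is constant. *)
Lemma windmill_epr_A : epr_term windmill_mx m.*2 = eprA.
Proof.
apply/epr_term_AP => a am.
have /cards1P [x xa] : #|~: a| == 1%N.
  by have := cardsC a; rewrite card_ord am; lia.
have inaE i : (i \in a) = (i != x) by rewrite -[a]setCK xa !inE.
apply/principal_minor_eq0P => -[v [v0 va vB]].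
have vx : v 0 x = 0 by apply: va; rewrite inaE eqxx.
have {}vB j : (v *m windmill_mx) 0 j = 0.
  have [->|jx] := eqVneq j x; last by rewrite vB ?inaE.
  have : (v *m windmill_mx *m (const_mx 1 : 'rV_m.*2.+1)^T) 0 0 = 0.
    rewrite -mulmxA -[windmill_mx]windmill_mx_tr -trmx_mul windmill_kernel.
    by rewrite linear0 mulmx0 mxE.
  rewrite mxE (bigD1 x) //= big1 => [|l lx]; last by rewrite vB ?mul0r // inaE.
  by rewrite !mxE mulr1 addr0.
have vc i : v 0 i = v 0 c.
  have [->//|/windmill_center im] := eqVneq i c.
  have [j [ji j2 jm]] := pairing_mate (leqnSn _) im.
  have := vB j; rewrite (@mul_windmill_mx _ i) 1?eq_sym // => /eqP.
  by rewrite addr_eq0 F2_opp => /eqP.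
by case/eqP: v0; apply/rowP => i; rewrite mxE vc -(vc x).
Qed.

(** Both a zero and a nonzero minor are found off the centre, where only the matching remains. *)
Lemma windmill_epr_S t : (0 < t < m)%N -> epr_term windmill_mx t.*2 = eprS.
Proof.
case/andP => t0 tm; have tn : (t.*2 < m.*2.+1)%N by lia.
have [a [at2 amax a0]] := pairing_minor_eq0 m t0 tn.
have ca : c \notin a by apply/negP => /amax /=; lia.
apply: (epr_term_S (card_ord_lt (ltnW tn)) _ at2); last by rewrite windmill_minor.
rewrite windmill_minor; last by rewrite inE /= -leqNgt leq_double ltnW.
exact: (pairing_minor_neq0 (leqnSn _) (ltnW tm)).
Qed.

End Windmill.

(** * Sequences of the model matrices and the classification *)

Lemma epr_term_N_from n (B : 'M['F_2]_n) k j :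
  B^T = B -> (forall i, B i i = 0) -> epr_term B k.*2 = eprN ->
  (k.*2 <= j <= n)%N -> epr_term B j = eprN.
Proof.
move=> BT B0 Bk; have [oj /andP [_ jn]|ej] := boolP (odd j).
  exact: epr_term_odd.
rewrite -[j]odd_double_half (negbTE ej) add0n; elim: j./2 => [|i IHi] /andP [ki ni].
  by move: ki Bk; rewrite leqn0 double_eq0 => /eqP ->.
have [->//|ik] := eqVneq i.+1 k.
by apply: epr_term_N_next => //; apply: IHi; lia.
Qed.

Lemma epr_head_N (F : fieldType) n (B : 'M[F]_n) :
  ohead (epr B) = Some eprN -> (0 < n)%N /\ forall i, B i i = 0.
Proof.
case: n B => // n B [B1]; split=> // i; apply: principal_minor_set1.
by move/(epr_term_NP B (ltn0Sn n)): B1; apply; rewrite cards1.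
Qed.

Definition complete_mx n : 'M['F_2]_n := \matrix_(i, j) (i != j)%:R.

Lemma complete_epr k r : (r <= 1)%N ->
  epr (complete_mx (k.*2 + r)) = rep [:: eprN; eprA] k ++ nseq r eprN.
Proof.
move=> r1; set B := complete_mx _.
have BT : B^T = B by apply/matrixP => i j; rewrite !mxE eq_sym.
have B0 i : B i i = 0 by rewrite mxE eqxx.
rewrite (@epr_rep_cat _ _ BT B0 eprA k r) // => [|i _]; last first.
  by apply: epr_term_complete => [//|x y xy|]; rewrite ?mxE ?xy ?odd_double.
congr (_ ++ _); case: r r1 @B BT B0 => [|[|]] //= _ BT B0.
by rewrite (epr_term_odd BT B0) ?addn1 //= odd_double.
Qed.

Lemma pairing_epr k m :
  epr (pairing_mx (k.*2 + m.+1) k) = rep [:: eprN; eprS] k ++ rep [:: eprN] m.+1.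
Proof.
have [BT B0] := (pairing_mx_tr (k.*2 + m.+1) k, @pairing_mx_diag (k.*2 + m.+1) k).
rewrite (@epr_rep_cat _ _ BT B0 eprS k m.+1) // => [|i ik]; last first.
  by apply: pairing_epr_S => //; lia.
congr (_ ++ _); apply: map_iota_rep1 => i im; apply: pairing_epr_N; lia.
Qed.

Lemma pairing_epr_full k :
  epr (pairing_mx k.+1.*2 k.+1) = rep [:: eprN; eprS] k ++ [:: eprN; eprA].
Proof.
have [BT B0] := (pairing_mx_tr k.+1.*2 k.+1, @pairing_mx_diag k.+1.*2 k.+1).
rewrite (@epr_rep_cat _ _ BT B0 eprS k 2) ?doubleS ?addn2 // => [|i ik].
  congr (_ ++ _); rewrite /= -doubleS pairing_epr_A.
  by rewrite (epr_term_odd BT B0) ?doubleS //= odd_double.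
by rewrite -doubleS; apply: pairing_epr_S; lia.
Qed.

Lemma windmill_epr k :
  epr (windmill_mx k.+1) = rep [:: eprN; eprS] k ++ [:: eprN; eprA; eprN].
Proof.
have [BT B0] := (windmill_mx_tr k.+1, @windmill_mx_diag k.+1).
rewrite (@epr_rep_cat _ _ BT B0 eprS k 3) ?doubleS ?addn3 // => [|i ik].
  congr (_ ++ _); rewrite /= -doubleS windmill_epr_A.
  by rewrite !(epr_term_odd BT B0) ?doubleS //= ?odd_double // ltnS ltnW.
by apply: windmill_epr_S; lia.
Qed.

Lemma attainable_forms n (B : 'M['F_2]_n) :
  (0 < n)%N -> B^T = B -> (forall i, B i i = 0) ->
  [\/ exists k, epr B = rep [:: eprN; eprA] k.+1,
      exists k, epr B = rep [:: eprN; eprA] k.+1 ++ [:: eprN],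
      exists k m, epr B = rep [:: eprN; eprS] k ++ rep [:: eprN] m.+1
    | (exists k, epr B = rep [:: eprN; eprS] k.+1 ++ [:: eprN; eprA]) \/
      (exists k, epr B = rep [:: eprN; eprS] k.+1 ++ [:: eprN; eprA; eprN])].
Proof.
move=> n0 BT B0; pose f := epr_term B.
(* The least [k] with [stop k] is the number of leading NS blocks: position 2k + 2 is the first even
   one that exceeds [n] or is not S. *)
pose stop j := (n < j.+1.*2)%N || (if f j.+1.*2 is eprS then false else true).
have ex_stop : exists j, stop j by exists n; rewrite /stop; apply/orP; left; lia.
have [k stopk mink] := ex_minnP ex_stop.
have fS i : (0 < i <= k)%N -> (i.*2 <= n)%N /\ f i.*2 = eprS.
  case: i => // i /= ik; have : ~~ stop i by apply: contraL ik => /mink; rewrite -leqNgt.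
  by rewrite /stop negb_or -leqNgt => /andP [-> ]; case: (f _).
have fS' i ik := (fS i ik).2.
have fodd i : (i <= n)%N -> odd i -> f i = eprN by apply: epr_term_odd.
have le_kn : (k.*2 <= n)%N.
  by case: (posnP k) => [->//|k0]; apply: (fS k _).1; rewrite k0 leqnn.
have [nk|kn] := ltnP n k.+1.*2.
  (* The order cannot be 2k, since the last term would then be S. *)
  have nE : n = (k.*2 + 1)%N.
    have : n <> k.*2; last by lia.
    move=> n2k; apply: (@epr_term_last _ n B).
    by have := fS' k; rewrite -n2k; apply; lia.
  constructor 3; exists k, 0%N; rewrite (epr_rep_cat BT B0 nE fS') /=.
  by rewrite [epr_term _ _]fodd ?nE ?addn1 //= odd_double.
case fk : (f k.+1.*2); last 1 first.
- constructor 3; exists k, (n - k.*2.+1)%N.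
  have nE : n = (k.*2 + (n - k.*2.+1).+1)%N by lia.
  rewrite (epr_rep_cat BT B0 nE fS'); congr (_ ++ _).
  apply: map_iota_rep1 => -[|i] im.
    by rewrite addn0; apply: fodd; rewrite /= ?odd_double //; lia.
  by apply: (epr_term_N_from BT B0 fk); lia.
(* An A in position 2 makes [B] complete as soon as [n] is at least 4; the parity of [n] separates
   the first two forms. *)
- have [k0|k0] := posnP k.
    have fA i : (0 < i <= n./2)%N -> f i.*2 = eprA.
      case: i => [|[|i]] // ni; first by rewrite -fk k0.
      apply: epr_term_complete => //; last by rewrite odd_double.
      by apply: (epr_term_A_complete BT B0 _ _ fk) => //; lia.
    have nE := odd_double_half n; have n2 : (0 < n./2)%N by lia.
    have nE' : n = (n./2.*2 + odd n)%N by lia.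
    have := epr_rep_cat BT B0 nE' fA; case: n./2 n2 nE' => // m _ nE'.
    case: odd nE' => nE' ->; last by constructor 1; exists m; rewrite cats0.
    constructor 2; exists m; congr (_ ++ _); rewrite /= [epr_term _ _]fodd //=.
      by rewrite /= in nE'; lia.
    by rewrite odd_double.
  (* Otherwise the A in position 2k + 2 would make [B] complete and turn the S in position 2 into an
     A. *)
  have nk : (n < k.+2.*2)%N.
    rewrite ltnNge; apply/negP => nk.
    have := fS' 1%N; rewrite k0 => /(_ isT).
    rewrite /f epr_term_complete //.
    by apply: (epr_term_A_complete BT B0 _ _ fk).
  have [r r1 nE] : exists2 r, (r <= 1)%N & n = (k.*2 + r.+2)%N.
    by exists (n - k.+1.*2)%N; lia.
  have fk1 : f k.*2.+1 = eprN by rewrite fodd //= ?odd_double //; lia.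
  case: k k0 nE fk fk1 fS' {stopk mink fS le_kn kn nk} => // k _ nE fk fk1 fS'.
  constructor 4; rewrite (epr_rep_cat BT B0 nE fS').
  case: r r1 nE => [|[|//]] _ nE; [left | right]; exists k; congr (_ ++ _) => /=.
    by congr [:: _; _].
  congr [:: _; _; _] => //; rewrite [LHS]fodd //= ?odd_double //; lia.
by move: stopk; rewrite /stop ltnNge kn fk.
Qed.

Theorem theorem3p2 (s : seq epr_symbol) (hs : ohead s = Some eprN) :
  attainable 'F_2 s <->
  [\/ exists k : nat, s = [:: eprN; eprA] ++ rep [:: eprN; eprA] k,
      exists k : nat, s = [:: eprN; eprA] ++ rep [:: eprN; eprA] k ++ [:: eprN],
      exists k m : nat, s = rep [:: eprN; eprS] k ++ [:: eprN] ++ rep [:: eprN] m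
    | (exists k : nat,
         s = [:: eprN; eprS] ++ rep [:: eprN; eprS] k ++ [:: eprN; eprA]) \/
      (exists k : nat,
         s = [:: eprN; eprS] ++ rep [:: eprN; eprS] k ++ [:: eprN; eprA; eprN])].
Proof.
split=> [[n [B [n0 BT BE]]]|].
  by move: hs; rewrite -BE => /epr_head_N [_]; apply: attainable_forms.
case=> [[k ->]|[k ->]|[k [m ->]]|[[k ->]|[k ->]]].
- exists _, (complete_mx (k.+1.*2 + 0)); split; first by lia.
    by apply/matrixP => i j; rewrite !mxE eq_sym.
  by rewrite complete_epr // cats0.
- exists _, (complete_mx (k.+1.*2 + 1)); split; first by lia.
    by apply/matrixP => i j; rewrite !mxE eq_sym.
  by rewrite complete_epr.
- exists _, (pairing_mx (k.*2 + m.+1) k); split; first by lia.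
    exact: pairing_mx_tr.
  exact: pairing_epr.
- by exists _, (pairing_mx k.+2.*2 k.+2); rewrite pairing_mx_tr pairing_epr_full.
(* A windmill has one NS block fewer than triangles. *)
- by exists _, (windmill_mx k.+2); rewrite windmill_mx_tr windmill_epr.
Qed.
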